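(* Let $\Sigma=(X,U,W,P,\mathcal P,\varsigma,F,Y,h)$ be a discrete-time stochastic switching system with modes $P=\{1,\dots,m\}$ and mode transition probabilities $\pi_{pp'}$, with continuous state, input and disturbance sets $X\subseteq\mathbb R^n$, $U\subseteq\mathbb R^{\bar m}$, $W\subseteq\mathbb R^{\bar p}$, and such that each $f_p:X\times U\times W\times\mathcal V_\varsigma\to X$ is a polynomial function of the state $x$, the input $\nu$ and the disturbance $w$. Let $X_0,X_u\subseteq X$ be initial and unsafe sets, and suppose that $X_0,X_u,X,U,W$ can be defined by vectors of polynomial inequalities as $X_0=\{x\in\mathbb R^n\mid g_0(x)\ge0\}$, $X_u=\{x\in\mathbb R^n\mid g_u(x)\ge0\}$, $X=\{x\in\mathbb R^n\mid g(x)\ge0\}$, $U=\{\nu\in\mathbb R^{\bar m}\mid g_\nu(\nu)\ge0\}$, $W=\{w\in\mathbb R^{\bar p}\mid g_w(w)\ge0\}$ (inequalities element-wise). Suppose there exist sum-of-squares polynomials $\mathcal B_p(x)$, constants $0<\kappa_p<1$, $\gamma_p,\lambda_p,\psi_p\in\mathbb R_{\ge0}$, a symmetric matrix $\mathcal X$ with conformal block partitions $\mathcal X^{l\bar l}$, $l,\bar l\in\{1,2\}$, polynomials $l_{\nu_{j_p}}(x)$ corresponding to the $j$-th input in $\nu=(\nu_1,\dots,\nu_{\bar m})\in U\subseteq\mathbb R^{\bar m}$, and vectors of sum-of-squares polynomials $l_{0_p}(x)$, $l_{u_p}(x)$, $l_p(x,\nu,w)$, $l_{\nu_p}(x,\nu,w)$,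 $l_{w_p}(x,\nu,w)$ of appropriate dimensions, such that for all $p\in P$ the following three expressions are sum-of-squares polynomials: $$-\mathcal B_p(x)-l_{0_p}^\top(x)\,g_0(x)+\gamma_p,$$ $$\mathcal B_p(x)-l_{u_p}^\top(x)\,g_u(x)-\lambda_p,$$ $$-\sum_{p'=1}^m\pi_{pp'}\mathbb E\big[\mathcal B_{p'}(x(k+1))\,\big|\,x,\nu,w,p\big]+\kappa_p\mathcal B_p(x)+\psi_p+\begin{bmatrix} w \\ h(x) \end{bmatrix}^\top\begin{bmatrix}\mathcal X^{11}&\mathcal X^{12} \\ \mathcal X^{21}&\mathcal X^{22}\end{bmatrix}\begin{bmatrix} w \\ h(x) \end{bmatrix}$$ $$\qquad-\sum_{j=1}^{\bar m}\big(\nu_j-l_{\nu_{j_p}}(x)\big)-l_p^\top(x,\nu,w)\,g(x)-l_{w_p}^\top(x,\nu,w)\,g_w(w)-l_{\nu_p}^\top(x,\nu,w)\,g_\nu(\nu).$$ Then $\mathcal B_p(x)$ satisfies the conditions of a control storage certificate, i.e. for all $p\in P$, $$\mathcal B_p(x)\le\gamma_p\ \ \forall x\in X_0,\qquad \mathcal B_p(x)\ge\lambda_p\ \ \forall x\in X_u,$$ and for every $x\in X$ there exists $\nu\in U$ such that for all $w\in W$ $$\sum_{p'=1}^m\pi_{pp'}\mathbb E\big[\mathcal B_{p'}(x(k+1))\,\big|\,x,\nu,w,p\big]\le\kappa_p\mathcal B_p(x)+\psi_p+\begin{bmatrix} w \\ h(x) \end{bmatrix}^\top\mathcal X\begin{bmatrix}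 w \\ h(x) \end{bmatrix};$$ and $\nu=[l_{\nu_{1_p}}(x);\dots;l_{\nu_{\bar m_p}}(x)]$ is the corresponding controller employed at the mode $p\in P$.
   Context: A discrete-time stochastic switching system is a tuple $\Sigma=(X,U,W,P,\mathcal P,\varsigma,F,Y,h)$ where $X\subseteq\mathbb R^n$, $U\subseteq\mathbb R^{\bar m}$, $W\subseteq\mathbb R^{\bar p}$, $Y\subseteq\mathbb R^q$ are Borel spaces (states, inputs, disturbances, outputs); $P=\{1,\dots,m\}$ is a finite set of modes; $\mathcal P$ is a set of switching signals $\mathbb N\to P$; $\varsigma=\{\varsigma(k)\}_{k\in\mathbb N}$ is an i.i.d. sequence of random variables with values in a measurable space $\mathcal V_\varsigma$; $F=\{f_1,\dots,f_m\}$ with $f_p:X\times U\times W\times\mathcal V_\varsigma\to X$ measurable; $h:X\to Y$ is measurable. The evolution is $x(k+1)=f_{\mathbf p(k)}(x(k),\nu(k),w(k),\varsigma(k))$, $y(k)=h(x(k))$, with $\nu(k),w(k)$ independent of $\varsigma(z)$ for $z\ge k$, and the mode switches according to a Markov chain: $\mathbb P\{\mathbf p(k+1)=p'\mid\mathbf p(k)=p\}=\pi_{pp'}$, $\pi_{pp'}\ge0$, $\sum_{p'=1}^m\pi_{pp'}=1$. The controller has access to the current mode. In $\mathbb E[\mathcal B_{p'}(x(k+1))\mid x,\nu,w,p]$ one has $x(k+1)=f_p(x,\nu,w,\varsigma(k))$. A polynomial is sum-of-squares if it is a finite sum of squares of real polynomials. The block partition of $\mathcal X$ is conformal with the vector $[w;h(x)]$.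 $[a;b]$ denotes a stacked column vector.
   Formalization: The formal theorem explicitly assumes that the polynomial controller [l_{ν_1p}(x);…;l_{ν_m̄p}(x)] lies in U for every x in X and every mode p; without this the stated conclusion can fail. *)

(* Defs.v *)
From HB Require Import structures.
From mathcomp Require Import all_boot all_order all_algebra.
From mathcomp Require Import all_classical all_reals all_analysis.
(* The notations of mpoly clash with those of MathComp-Analysis. *)
From mathcomp Require Import -(notations) mpoly.

Set Implicit Arguments.
Unset Strict Implicit.
Unset Printing Implicit Defensive.

Import Order.TTheory GRing.Theory Num.Theory.
Local Open Scope classical_set_scope.
Local Open Scope ring_scope.

Notation "{ 'mpoly' R [ n ] }" := (mpoly n R) : type_scope.

(* R^n is n.-tuple R, whose sigma-algebra in MathComp-Analysis is the product
   of the Borel sigma-algebras of the coordinates. *)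

Definition peval (R : realType) (n : nat) (p : {mpoly R[n]}) (x : n.-tuple R)
  : R := meval (tnth x) p.

Definition is_sos (R : realType) (n : nat) (p : {mpoly R[n]}) : Prop :=
  exists s : seq {mpoly R[n]}, p = \sum_(r <- s) r ^+ 2.

Definition basic_semialgebraic (R : realType) (n r : nat)
    (g : 'I_r -> {mpoly R[n]}) : set (n.-tuple R) :=
  [set x | forall i, 0 <= peval (g i) x].

(* [x; nu; w] *)
Definition stack3 (R : realType) (n mb pb : nat) (x : n.-tuple R)
    (u : mb.-tuple R) (w : pb.-tuple R) : (n + (mb + pb)).-tuple R :=
  [tuple of x ++ (u ++ w)].

(* An expression in the indeterminates (x, nu, w), given by its values, is a
   sum-of-squares polynomial. Its values lie in \bar R because it contains
   expectations; the equation forces them to be finite. *)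
Definition sos_expr (R : realType) (n mb pb : nat)
    (e : n.-tuple R -> mb.-tuple R -> pb.-tuple R -> \bar R) : Prop :=
  exists2 s : {mpoly R[n + (mb + pb)]}, is_sos s &
    forall x u w, e x u w = (peval s (stack3 x u w))%:E.

Definition mutually_independent (R : realType) (dO : measure_display)
    (Omega : measurableType dO) (Pr : probability Omega R)
    (dV : measure_display) (V : measurableType dV)
    (Z : nat -> Omega -> V) : Prop :=
  forall (J : seq nat) (A : nat -> set V), uniq J ->
    (forall k, measurable (A k)) ->
    Pr [set o | forall k, k \in J -> A k (Z k o)]
    = (\prod_(k <- J) Pr (Z k @^-1` A k))%E.

Definition identically_distributed (R : realType) (dO : measure_display)
    (Omega : measurableType dO) (Pr : probability Omega R)
    (dV : measure_display) (V : measurableType dV)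
    (Z : nat -> Omega -> V) : Prop :=
  forall (k l : nat) (A : set V), measurable A ->
    Pr (Z k @^-1` A) = Pr (Z l @^-1` A).

Definition iid (R : realType) (dO : measure_display)
    (Omega : measurableType dO) (Pr : probability Omega R)
    (dV : measure_display) (V : measurableType dV)
    (Z : nat -> Omega -> V) : Prop :=
  [/\ forall k, measurable_fun setT (Z k),
      mutually_independent Pr Z & identically_distributed Pr Z].

(* Stochastic switching systems with modes 'I_m (the mode p of {1, ..., m} is
   the ordinal p - 1). The maps f_p : X * U * W * V -> X and h : X -> Y are
   represented by total functions; only their behaviour on X, U, W is
   constrained. *)
Record switching_system (R : realType) (n mb pb q m : nat)
    (dO : measure_display) (Omega : measurableType dO)
    (Pr : probability Omega R)
    (dV : measure_display) (V : measurableType dV) := SwitchingSystem {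
  sys_X : set (n.-tuple R);
  sys_U : set (mb.-tuple R);
  sys_W : set (pb.-tuple R);
  sys_Y : set (q.-tuple R);
  sys_signals : set (nat -> 'I_m);
  sys_noise : nat -> Omega -> V;
  sys_f : 'I_m -> n.-tuple R -> mb.-tuple R -> pb.-tuple R -> V -> n.-tuple R;
  sys_h : n.-tuple R -> q.-tuple R;
  sys_pi : 'I_m -> 'I_m -> R;
  _ : measurable sys_X;
  _ : measurable sys_U;
  _ : measurable sys_W;
  _ : measurable sys_Y;
  _ : iid Pr sys_noise;
  _ : forall p, measurable_fun
        (((sys_X `*` sys_U) `*` sys_W) `*` [set: V])
        (fun z : n.-tuple R * mb.-tuple R * pb.-tuple R * V =>
           sys_f p z.1.1.1 z.1.1.2 z.1.2 z.2);
  _ : forall p x u w v, sys_X x -> sys_U u -> sys_W w ->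
        sys_X (sys_f p x u w v);
  _ : measurable_fun sys_X sys_h;
  _ : forall x, sys_X x -> sys_Y (sys_h x);
  _ : forall p p', 0 <= sys_pi p p';
  _ : forall p, \sum_(p' < m) sys_pi p p' = 1
}.

Definition polynomial_dynamics (R : realType) (n mb pb q m : nat)
    (dO : measure_display) (Omega : measurableType dO)
    (Pr : probability Omega R)
    (dV : measure_display) (V : measurableType dV)
    (S : switching_system n mb pb q m Pr V) : Prop :=
  forall (p : 'I_m) (v : V) (i : 'I_n),
    exists F : {mpoly R[n + (mb + pb)]},
      forall x u w, tnth (sys_f S p x u w v) i = peval F (stack3 x u w).

(* sum_p' pi_pp' E[B_p'(x(k+1)) | x, nu, w, p]. Since x(k), nu(k), w(k) are
   independent of the noise at time k, conditioning amounts to fixing their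
   values in x(k+1) = f_p(x, nu, w, noise(k)). *)
Definition expected_next (R : realType) (n mb pb q m : nat)
    (dO : measure_display) (Omega : measurableType dO)
    (Pr : probability Omega R)
    (dV : measure_display) (V : measurableType dV)
    (S : switching_system n mb pb q m Pr V)
    (B : 'I_m -> n.-tuple R -> R) (k : nat) (p : 'I_m)
    (x : n.-tuple R) (u : mb.-tuple R) (w : pb.-tuple R) : \bar R :=
  (\sum_(p' < m) (sys_pi S p p')%:E *
     'E_Pr[fun o : Omega => B p' (sys_f S p x u w (sys_noise S k o))])%E.

(* [w; y]^T M [w; y] *)
Definition supply_rate (R : realType) (pb q : nat) (M : 'M[R]_(pb + q))
    (w : pb.-tuple R) (y : q.-tuple R) : R :=
  let z : 'cV[R]_(pb + q) := col_mx (\col_i tnth w i) (\col_i tnth y i) in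
  (z^T *m M *m z) 0 0.

Definition dissipation (R : realType) (n mb pb q m : nat)
    (dO : measure_display) (Omega : measurableType dO)
    (Pr : probability Omega R)
    (dV : measure_display) (V : measurableType dV)
    (S : switching_system n mb pb q m Pr V)
    (B : 'I_m -> n.-tuple R -> R) (kappa psi : 'I_m -> R)
    (M : 'M[R]_(pb + q)) (p : 'I_m)
    (x : n.-tuple R) (u : mb.-tuple R) (w : pb.-tuple R) : Prop :=
  forall k : nat,
    (expected_next S B k p x u w <=
     (kappa p * B p x + psi p + supply_rate M w (sys_h S x))%:E)%E.

Definition storage_certificate (R : realType) (n mb pb q m : nat)
    (dO : measure_display) (Omega : measurableType dO)
    (Pr : probability Omega R)
    (dV : measure_display) (V : measurableType dV)
    (S : switching_system n mb pb q m Pr V) (X0 Xu : set (n.-tuple R))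
    (B : 'I_m -> n.-tuple R -> R) (kappa gamma lambda psi : 'I_m -> R)
    (M : 'M[R]_(pb + q)) : Prop :=
  forall p : 'I_m,
    [/\ forall x, X0 x -> B p x <= gamma p,
        forall x, Xu x -> lambda p <= B p x &
        forall x, sys_X S x -> exists2 u, sys_U S u &
          forall w, sys_W S w -> dissipation S B kappa psi M p x u w].

(* The feedback K provides at each mode p and state x an admissible input
   witnessing the last condition of a storage certificate. *)
Definition storage_controller (R : realType) (n mb pb q m : nat)
    (dO : measure_display) (Omega : measurableType dO)
    (Pr : probability Omega R)
    (dV : measure_display) (V : measurableType dV)
    (S : switching_system n mb pb q m Pr V)
    (B : 'I_m -> n.-tuple R -> R) (kappa psi : 'I_m -> R)
    (M : 'M[R]_(pb + q)) (K : 'I_m -> n.-tuple R -> mb.-tuple R) : Prop :=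
  forall (p : 'I_m) (x : n.-tuple R), sys_X S x ->
    sys_U S (K p x) /\
    forall w, sys_W S w -> dissipation S B kappa psi M p x (K p x) w.

Definition polynomial_feedback (R : realType) (n mb m : nat)
    (l : 'I_m -> 'I_mb -> {mpoly R[n]}) (p : 'I_m) (x : n.-tuple R)
  : mb.-tuple R := [tuple peval (l p j) x | j < mb].

(* Main.v *)
(* At nu = linput_p(x) the term sum_j (nu_j - l_{nu_j p}(x)) vanishes, so each
   sum-of-squares condition says that the wanted inequality holds up to products
   of sum-of-squares multipliers with constraint polynomials, and these products
   are nonnegative on the semialgebraic sets. *)

Require Import Defs.
From HB Require Import structures.
From mathcomp Require Import all_boot all_order all_algebra.
From mathcomp Require Import all_classical all_reals all_analysis.
From mathcomp Require Import -(notations) mpoly.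
From mathcomp Require Import lra.

Set Implicit Arguments.
Unset Strict Implicit.
Unset Printing Implicit Defensive.

Import Order.TTheory GRing.Theory Num.Theory.
Local Open Scope classical_set_scope.
Local Open Scope ring_scope.

Lemma peval_sum (R : realType) (n : nat) (I : Type) (s : seq I) (P : pred I)
    (F : I -> {mpoly R[n]}) (x : n.-tuple R) :
  peval (\sum_(i <- s | P i) F i) x = \sum_(i <- s | P i) peval (F i) x.
Proof. exact: raddf_sum. Qed.

Lemma peval_sos_ge0 (R : realType) (n : nat) (p : {mpoly R[n]}) :
  is_sos p -> forall x, 0 <= peval p x.
Proof.
move=> [s ->] x; rewrite peval_sum; apply: sumr_ge0 => r _.
by rewrite /peval rmorphXn sqr_ge0.
Qed.

(** Every term is a product of two nonnegative numbers. The points [y] and [x] are separate because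
    the multipliers of the dissipation condition depend on all of (x, nu, w), whereas each
    constraint vector sees only one of these blocks; the initial and unsafe conditions use the case
    where [y] is [x]. *)
Lemma sos_multipliers_ge0 (R : realType) (N n r : nat)
    (l : 'I_r -> {mpoly R[N]}) (g : 'I_r -> {mpoly R[n]})
    (y : N.-tuple R) (x : n.-tuple R) :
  (forall i, is_sos (l i)) -> basic_semialgebraic g x ->
  0 <= \sum_(i < r) peval (l i) y * peval (g i) x.
Proof.
move=> l_sos gx; apply: sumr_ge0 => i _.
by apply: mulr_ge0 (gx i); apply: peval_sos_ge0.
Qed.

(** An infinite [e] would make the left-hand side infinite, so the equation itself forces [e] to be
    finite. Applied to [expected_next], this spares any integrability argument. *)
Lemma oppeD_fin_ge0_le (R : realType) (e : \bar R) (r s : R) :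
  (- e + r%:E = s%:E)%E -> 0 <= s -> (e <= r%:E)%E.
Proof. by case: e => [e| |] //= [<-]; rewrite lee_fin addrC subr_ge0. Qed.

Theorem lemma5p1 (R : realType) (n mb pb q m : nat)
    (dO : measure_display) (Omega : measurableType dO)
    (Pr : probability Omega R)
    (dV : measure_display) (V : measurableType dV)
    (S : switching_system n mb pb q m Pr V)
    (f_poly : polynomial_dynamics S)
    (X0 Xu : set (n.-tuple R))
    (X0_sub : X0 `<=` sys_X S) (Xu_sub : Xu `<=` sys_X S)
    (r0 ru rx rv rw : nat)
    (g0 : 'I_r0 -> {mpoly R[n]}) (gu : 'I_ru -> {mpoly R[n]})
    (gx : 'I_rx -> {mpoly R[n]}) (gv : 'I_rv -> {mpoly R[mb]})
    (gw : 'I_rw -> {mpoly R[pb]})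
    (X0E : X0 = basic_semialgebraic g0)
    (XuE : Xu = basic_semialgebraic gu)
    (XE : sys_X S = basic_semialgebraic gx)
    (UE : sys_U S = basic_semialgebraic gv)
    (WE : sys_W S = basic_semialgebraic gw)
    (B : 'I_m -> {mpoly R[n]}) (B_sos : forall p, is_sos (B p))
    (kappa gamma lambda psi : 'I_m -> R)
    (kappa_itv : forall p, 0 < kappa p < 1)
    (gamma_ge0 : forall p, 0 <= gamma p)
    (lambda_ge0 : forall p, 0 <= lambda p)
    (psi_ge0 : forall p, 0 <= psi p)
    (X11 : 'M[R]_pb) (X12 : 'M[R]_(pb, q))
    (X21 : 'M[R]_(q, pb)) (X22 : 'M[R]_q)
    (X_sym : (block_mx X11 X12 X21 X22)^T = block_mx X11 X12 X21 X22)
    (linput : 'I_m -> 'I_mb -> {mpoly R[n]})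
    (linput_U : forall p x, sys_X S x ->
       sys_U S (polynomial_feedback linput p x))
    (l0 : 'I_m -> 'I_r0 -> {mpoly R[n]})
    (lu : 'I_m -> 'I_ru -> {mpoly R[n]})
    (lx : 'I_m -> 'I_rx -> {mpoly R[n + (mb + pb)]})
    (lv : 'I_m -> 'I_rv -> {mpoly R[n + (mb + pb)]})
    (lw : 'I_m -> 'I_rw -> {mpoly R[n + (mb + pb)]})
    (l0_sos : forall p i, is_sos (l0 p i))
    (lu_sos : forall p i, is_sos (lu p i))
    (lx_sos : forall p i, is_sos (lx p i))
    (lv_sos : forall p i, is_sos (lv p i))
    (lw_sos : forall p i, is_sos (lw p i))
    (sos_initial : forall p,
       is_sos (- B p - \sum_(i < r0) l0 p i * g0 i
               + mpolyC n (gamma p)))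
    (sos_unsafe : forall p,
       is_sos (B p - \sum_(i < ru) lu p i * gu i
               - mpolyC n (lambda p)))
    (sos_dissipation : forall p k,
       sos_expr (fun x u w =>
         (- expected_next S (fun p' => peval (B p')) k p x u w
          + (kappa p * peval (B p) x + psi p
             + supply_rate (block_mx X11 X12 X21 X22) w (sys_h S x)
             - \sum_(j < mb) (tnth u j - peval (linput p j) x)
             - \sum_(i < rx) peval (lx p i) (stack3 x u w) * peval (gx i) x
             - \sum_(i < rw) peval (lw p i) (stack3 x u w) * peval (gw i) w
             - \sum_(i < rv) peval (lv p i) (stack3 x u w) * peval (gv i) u
            )%R%:E)%E)) :
  storage_certificate S X0 Xu (fun p => peval (B p))
    kappa gamma lambda psi (block_mx X11 X12 X21 X22) /\
  storage_controller S (fun p => peval (B p))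
    kappa psi (block_mx X11 X12 X21 X22) (polynomial_feedback linput).
Proof.
(* The controller property comes first, since it supplies the witness for the existential clause of
   the certificate. *)
have ctrl : storage_controller S (fun p => peval (B p)) kappa psi
    (block_mx X11 X12 X21 X22) (polynomial_feedback linput).
  (* Admissibility of the feedback value serves twice: as the first half of the goal, and below to
     make the products of [lv] with [gv] nonnegative. *)
  move=> p x Xx; have Ux := linput_U p x Xx; split=> // w Ww k.
  have [s s_sos /(_ x (polynomial_feedback linput p x) w)] :=
    sos_dissipation p k.
  set y := stack3 _ _ _ => sE.
  (* What remains is a real inequality: the bracket of the sum-of-squares condition is at most the
     dissipation bound. *)
  apply: le_trans (oppeD_fin_ge0_le sE (peval_sos_ge0 s_sos y)) _.
  rewrite XE in Xx; rewrite UE in Ux; rewrite WE in Ww.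
  (* The selected sum has no definite sign for a general input, hence the evaluation at the feedback
     value. *)
  rewrite lee_fin [X in _ - X - _ - _ - _]big1 ?subr0; last first.
    by move=> j _; rewrite tnth_mktuple subrr.
  have := sos_multipliers_ge0 y (lx_sos p) Xx.
  have := sos_multipliers_ge0 y (lw_sos p) Ww.
  have := sos_multipliers_ge0 y (lv_sos p) Ux.
  by lra.
split=> // p; split.
- move=> x; rewrite X0E => gx0.
  have := peval_sos_ge0 (sos_initial p) x.
  have := sos_multipliers_ge0 x (l0_sos p) gx0.
  rewrite /peval mevalD mevalB mevalN mevalC -!/(peval _ _) peval_sum.
  (* Evaluation is pushed through the products so that both hypotheses contain the same sum, which
     [lra] then treats as one atom. *)
  under [in X in _ -> X -> _]eq_bigr do rewrite /peval mevalM.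
  by rewrite /peval; lra.
- move=> x; rewrite XuE => gxu.
  have := peval_sos_ge0 (sos_unsafe p) x.
  have := sos_multipliers_ge0 x (lu_sos p) gxu.
  rewrite /peval !mevalB mevalC -!/(peval _ _) peval_sum.
  under [in X in _ -> X -> _]eq_bigr do rewrite /peval mevalM.
  by rewrite /peval; lra.
(* The witness depends on [p] and [x] only, so it may be given before [w]. *)
- move=> x Xx; have [Ux dis] := ctrl p x Xx.
  by exists (polynomial_feedback linput p x).
Qed.
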